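(* Let $m\ge 6$ and $n\ge 6$. The variance of the number of sinks in a randomly labeled $m\times n$ GIG digraph is $$\frac{13mn}{225}+\frac{m+n}{150}+\frac{52}{1575}.$$
   Context: The vertex set $V$ is the $m\times n$ integer lattice $\{1,\ldots,m\}\times\{1,\ldots,n\}$. Two vertices are called neighbors if they are at Euclidean distance exactly $1$ in the lattice. For a vertex $V_a$, $N(V_a)$ is the set consisting of $V_a$ and its neighbors. A labeling is a bijection from $V$ to $\{1,\ldots,mn\}$; the label of $V_a$ is denoted $v_a$. The GIG (Greatest Increase Grid) digraph of a labeling is the digraph on $V$ in which $(V_a,V_b)$ is a directed edge if and only if $a\ne b$ and $v_b$ is the maximum of the labels of the vertices in $N(V_a)$. A vertex is a sink if its outdegree is $0$. A randomly labeled $m\times n$ GIG digraph is the GIG digraph of a labeling chosen uniformly at random among all $(mn)!$ labelings. *)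

(* Defs.v *)
From mathcomp Require Import all_boot all_order all_algebra.

Set Implicit Arguments.
Unset Strict Implicit.
Unset Printing Implicit Defensive.

Import GRing.Theory.
Local Open Scope ring_scope.

Section GIG.

Variables m n : nat.

(* Coordinates are 0-based: (i, j) stands for the lattice point
   (i + 1, j + 1). *)
Definition vertex : finType := ('I_m * 'I_n)%type.

Definition sqdist (a b : vertex) : int :=
  (a.1%:Z - b.1%:Z) ^+ 2 + (a.2%:Z - b.2%:Z) ^+ 2.

(* Euclidean distance exactly 1, i.e. squared distance exactly 1. *)
Definition neighbor (a b : vertex) : bool := sqdist a b == 1.

Definition closed_nbhd (a : vertex) : {set vertex} :=
  a |: [set b | neighbor a b].

(* The element k of 'I_(m * n) encodes the label k + 1, see label. *)
Definition labeling : finType := {ffun vertex -> 'I_(m * n)}.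

Definition labelings : {set labeling} :=
  [set f : labeling | injectiveb f && [forall k, exists a, f a == k]].

Definition label (f : labeling) (a : vertex) : nat := (f a).+1.

Definition gig_edge (f : labeling) : rel vertex :=
  fun a b => (a != b) && (label f b == \max_(c in closed_nbhd a) label f c)%N.

Definition outdegree (e : rel vertex) (a : vertex) : nat := #|[set b | e a b]|.

Definition is_sink (e : rel vertex) (a : vertex) : bool := outdegree e a == 0%N.

Definition num_sinks (e : rel vertex) : nat := #|[set a | is_sink e a]|.

End GIG.

(* Expectation and variance of X at a uniformly random element of S; they are
   meaningful only for nonempty S. *)
Section Uniform.

Variables (R : realFieldType) (T : finType) (S : {set T}).

Definition uniform_expectation (X : T -> R) : R :=
  (\sum_(t in S) X t) / #|S|%:R.

Definition uniform_variance (X : T -> R) : R :=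
  uniform_expectation (fun t => (X t - uniform_expectation X) ^+ 2).

End Uniform.

Lemma card_labelings (m n : nat) : #|labelings m n| = ((m * n)`!)%N.
Proof.
have cardV : #|vertex m n| = (m * n)%N by rewrite card_prod !card_ord.
transitivity (#|[set f : labeling m n | injectiveb f]|).
  apply: eq_card => f; rewrite !inE; case: (boolP (injectiveb f)) => //= injf.
  apply/forallP => k; apply/existsP.
  have [|g _ gK] := inj_card_bij (injectiveP _ injf).
    by rewrite cardV card_ord.
  by exists (g k); rewrite gK.
by rewrite card_inj_ffuns cardV card_ord ffactnn.
Qed.

(* Main.v *)
Require Import Defs.
From mathcomp Require Import all_boot all_order all_algebra.
From mathcomp Require Import all_fingroup zify ring.

(* A vertex is a sink iff it carries the largest label of its closed
   neighborhood, so the number of sinks is a sum of indicators and its variance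
   is the sum of all pairwise covariances. Permuting labels inside a set shows
   that each of its points is equally likely to carry the largest label. Hence
   a vertex whose closed neighborhood A has p points is a sink with probability
   1/p. Two adjacent vertices are never both sinks. For distinct non-adjacent
   vertices with neighborhoods A and B of sizes p and q, the largest label of
   A :|: B must sit on one of the two vertices, and the other one is then
   independently the maximum of its own neighborhood; so with
   u = #|A :|: B| both are sinks with probability (p + q) / (u p q), and the
   covariance is #|A :&: B| / (u p q), which vanishes beyond distance 2. The
   covariance depends only on the coordinate differences and on the degrees of
   the coordinates in the two path factors of the grid, so the double sum is
   evaluated one coordinate at a time. *)

Set Implicit Arguments.
Unset Strict Implicit.
Unset Printing Implicit Defensive.

Import Order.TTheory GRing.Theory Num.Theory.

(** * Counting injective labelings by where their largest labels lie *)

Section Argmax.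

Variables (V : finType) (N : nat).
Implicit Types (f : {ffun V -> 'I_N}) (A B : {set V}) (a b : V).

Definition argmax f A a := (a \in A) && [forall c in A, f c <= f a].

Lemma argmaxP f A a :
  reflect (a \in A /\ forall c, c \in A -> f c <= f a) (argmax f A a).
Proof.
by apply: (iffP andP) => -[aA fA]; split=> //; [exact/forall_inP | exact/forall_inP].
Qed.

Lemma sum_argmax f A a0 : injective f -> a0 \in A ->
  \sum_(a in A) argmax f A a = 1.
Proof.
move=> fI a0A; case: (@arg_maxnP _ a0 (mem A) (fun a => f a : nat)) => // a aA fa.
rewrite (bigD1 a) //= big1 ?addn0 => [|b /andP[bA bNa]].
  by rewrite (introT (argmaxP _ _ _)) //; split.
apply/eqP; rewrite eqb0; apply: contra bNa => /argmaxP[_ /(_ a aA) le_ab].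
by apply/eqP/fI/val_inj/eqP; rewrite eqn_leq le_ab andbT; apply: fa.
Qed.

Definition relabel (s : {perm V}) f : {ffun V -> 'I_N} := [ffun x => f (s x)].

Lemma relabelK s : cancel (relabel s) (relabel s^-1).
Proof. by move=> f; apply/ffunP=> x; rewrite !ffunE permKV. Qed.

Lemma relabelVK s : cancel (relabel s^-1) (relabel s).
Proof. by move=> f; apply/ffunP=> x; rewrite !ffunE permK. Qed.

Lemma injectiveb_relabel s f : injectiveb (relabel s f) = injectiveb f.
Proof.
suff H t (g : {ffun V -> 'I_N}) : injectiveb g -> injectiveb (relabel t g).
  by apply/idP/idP => /H => [/(_ s^-1%g)|]; rewrite ?relabelK.
by move=> /injectiveP gI; apply/injectiveP=> x y; rewrite !ffunE => /gI /perm_inj.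
Qed.

Lemma argmax_relabel s f A a : perm_on A s ->
  argmax (relabel s f) A a = argmax f A (s a).
Proof.
move=> sA; rewrite /argmax perm_closed // !ffunE; congr (_ && _).
apply/forall_inP/forall_inP => H c cA.
  have := H ((s^-1)%g c); rewrite ffunE permKV; apply.
  by rewrite -(perm_closed _ sA) permKV.
by rewrite ffunE; apply: H; rewrite perm_closed.
Qed.

Definition inj_labels : {set {ffun V -> 'I_N}} :=
  [set f : {ffun V -> 'I_N} | injectiveb f].

(** Transposing [a] with another point of [A] preserves [E] and moves the maximum there, so all
    points of [A] have equal counts; each labeling in [E] has exactly one maximum on [A]. Invariance
    of [E] acts as independence. *)
Lemma card_argmax (E : pred {ffun V -> 'I_N}) A a :
    a \in A -> (forall s f, perm_on A s -> E (relabel s f) = E f) ->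
  #|[set f in inj_labels | E f && argmax f A a]| * #|A|
    = #|[set f in inj_labels | E f]|.
Proof.
move=> aA Es.
pose M b := [set f in inj_labels | E f && argmax f A b].
have cardM b : b \in A -> #|M b| = #|M a|.
  move=> bA; have sA : perm_on A (tperm a b).
    apply: (subset_trans (tperm_on a b)); by apply/subsetP=> x /set2P[]->.
  rewrite -(card_imset _ (can_inj (relabelK (tperm a b)))).
  apply: eq_card => f; rewrite -[f in LHS](relabelVK (tperm a b)).
  rewrite mem_imset; last exact: can_inj (relabelK _).
  rewrite tpermV !inE injectiveb_relabel Es //.
  by rewrite argmax_relabel // tpermR.
rewrite -[#|M a|]/#|M a| mulnC -sum_nat_const.
transitivity (\sum_(b in A) #|M b|); first by apply: eq_bigr => b /cardM.
(* Double counting of the pairs of a labeling and its maximal point in [A]. *)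
under eq_bigr => b _ do rewrite -sum1_card big_mkcond /=.
rewrite exchange_big /= -sum1_card [RHS]big_mkcond /=.
apply: eq_bigr => f _; rewrite !inE.
case: ifP => [/andP[fI Ef]|fNE].
  rewrite -[RHS](sum_argmax (injectiveP _ fI) aA); apply: eq_bigr => b bA.
  by rewrite !inE fI Ef /=; case: argmax.
by rewrite big1 // => b _; rewrite !inE andbA fNE.
Qed.

Lemma card_argmax1 A a : a \in A ->
  #|[set f in inj_labels | argmax f A a]| * #|A| = #|inj_labels|.
Proof.
by move=> aA; rewrite (@card_argmax xpredT A a aA) //;
  apply: eq_card => f; rewrite !inE andbT.
Qed.

(** A permutation supported on [B] fixes [a] and preserves [A], so the event at [a] is an admissible
    [E] for the count on [B]. *)
Lemma card_argmax_nested A B a b : a \in A -> b \in B -> B \subset A -> a \notin B ->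
  #|[set f in inj_labels | argmax f A a && argmax f B b]| * #|B| * #|A|
    = #|inj_labels|.
Proof.
pose E (f : {ffun V -> 'I_N}) := argmax f A a.
move=> aA bB BA aB; rewrite (@card_argmax E) ?card_argmax1 //.
move=> s f sB; rewrite /E argmax_relabel; last exact: subset_trans sB BA.
by rewrite (out_perm sB aB).
Qed.

(** Whichever of [a] and [b] has the larger label is the maximum of the union; distinct labels make
    the two cases exclusive. *)
Lemma argmaxU f A B a b : injective f ->
    a \in A -> b \in B -> a \notin B -> b \notin A ->
  argmax f A a && argmax f B b
    = (argmax f (A :|: B) a && argmax f B b)
      (+) (argmax f (A :|: B) b && argmax f A a) :> bool.
Proof.
move=> fI aA bB aB bA.
have neq_ab : f a != f b :> nat.
  by apply: contraNneq aB => /val_inj/fI->.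
have UE x y (C D : {set V}) : x \in C -> y \in D -> argmax f C x -> argmax f D y ->
   argmax f (C :|: D) x = (f y <= f x).
  move=> xC yD /argmaxP[_ Hx] /argmaxP[_ Hy]; apply/argmaxP/idP => [[_]|le_yx].
    by apply; rewrite inE yD orbT.
  split=> [|c]; rewrite inE ?xC // => /orP[/Hx //|/Hy cy]; exact: leq_trans le_yx.
case Ha: (argmax f A a); case Hb: (argmax f B b); rewrite ?andbF ?andbT //=.
- by rewrite (UE a b) // setUC (UE b a) //; lia.
- apply/esym/negbTE; apply: contraFN Hb => /argmaxP[_ H].
  by apply/argmaxP; split=> // c cB; apply: H; rewrite inE cB orbT.
- rewrite addbF; apply/esym/negbTE; apply: contraFN Ha => /argmaxP[_ H].
  by apply/argmaxP; split=> // c cA; apply: H; rewrite inE cA.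
Qed.

(** Both cases of [argmaxU] are nested counts, giving 1/(uq) + 1/(up) = (p + q)/(upq), here with
    denominators cleared to stay in [nat]. *)
Lemma card_argmax2 A B a b : a \in A -> b \in B -> a \notin B -> b \notin A ->
  #|[set f in inj_labels | argmax f A a && argmax f B b]|
     * (#|A :|: B| * #|A| * #|B|)
  = (#|A| + #|B|) * #|inj_labels|.
Proof.
move=> aA bB aB bA.
set U := A :|: B.
have -> : #|[set f in inj_labels | argmax f A a && argmax f B b]| =
  #|[set f in inj_labels | argmax f U a && argmax f B b]|
  + #|[set f in inj_labels | argmax f U b && argmax f A a]|.
  rewrite -!sum1_card ![\sum_(i in _) 1]big_mkcond -big_split /=.
  apply: eq_bigr => f _; rewrite !inE; case: injectiveP => //= fI.
  (* If both alternatives held, [a] and [b] would each carry the largest label of [U], forcing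
     [a = b]. *)
  rewrite argmaxU //; case: (boolP (_ && _)) => [/andP[/argmaxP[_ ab] _]|].
    2: by case: ifP.
  case: (boolP (_ && _)) => //= /andP[/argmaxP[_ ba] _].
  case/negP: aB; suff -> : a = b by [].
  by apply/fI/val_inj/eqP; rewrite eqn_leq ba ?inE ?aA // ab // inE bB orbT.
rewrite !mulnDl; congr (_ + _).
  rewrite -(@card_argmax_nested U B a b) ?inE ?aA ?subsetUr //; ring.
by rewrite -(@card_argmax_nested U A b a) ?inE ?bB ?orbT ?subsetUl //; ring.
Qed.

End Argmax.

(** * Distances and closed neighborhoods in the grid *)

Definition dist (x y : nat) : nat := (x - y) + (y - x).

(* Degree of i in the path graph on {0, ..., m - 1}. *)
Definition path_degree (m i : nat) : nat := (0 < i) + (i.+1 < m).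

(* Number of common points of the closed neighborhoods of two distinct
   non-adjacent grid points whose coordinates differ by d and e. *)
Definition overlap (d e : nat) : nat :=
  if (d == 1) && (e == 1) then 2 else d + e == 2.

Section Grid.

Variables m n : nat.
Implicit Types a b c : vertex m n.

Lemma labelingsE : labelings m n = inj_labels (vertex m n) (m * n).
Proof.
apply/eqP; rewrite eqEcard; apply/andP; split.
  by apply/subsetP=> f; rewrite !inE => /andP[].
by rewrite card_labelings card_inj_ffuns card_prod !card_ord ffactnn.
Qed.

Definition griddist a b := dist a.1 b.1 + dist a.2 b.2.

Lemma distC x y : dist x y = dist y x.
Proof. by rewrite /dist addnC. Qed.

Lemma dist_eq0 x y : (dist x y == 0) = (x == y).
Proof. by rewrite addn_eq0 !subn_eq0 -eqn_leq. Qed.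

Lemma dist_triangle x y z : dist x y <= dist x z + dist y z.
Proof. by rewrite /dist; lia. Qed.

Lemma dist_midpoint x y z : dist x y = 2 ->
  (dist x z == 1) && (dist y z == 1) = (z == (x + y)./2).
Proof. by rewrite /dist; lia. Qed.

Lemma griddist_eq0 a b : (griddist a b == 0) = (a == b).
Proof.
case: a b => [i j] [i' j'].
by rewrite addn_eq0 !dist_eq0 xpair_eqE.
Qed.

(** Two squares of naturals sum to 1 exactly when their roots do, so taxicab distance can replace
    Euclidean distance. *)
Lemma neighborE a b : neighbor a b = (griddist a b == 1).
Proof.
have sqE (x y : nat) : ((x%:Z - y%:Z) ^+ 2 = (dist x y ^ 2)%N%:Z :> int)%R.
  have [xy|/ltnW yx] := leqP x y.
    have -> : dist x y = y - x by rewrite /dist; lia.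
    by rewrite -sqrrN opprB subzn // expr2 -PoszM mulnn.
  have -> : dist x y = x - y by rewrite /dist; lia.
  by rewrite subzn // expr2 -PoszM mulnn.
rewrite /neighbor /sqdist !sqE /griddist.
case: (dist a.1 b.1) => [|[|p]]; case: (dist a.2 b.2) => [|[|q]]; lia.
Qed.

Lemma in_closed_nbhd a c : (c \in closed_nbhd a) = (griddist a c <= 1).
Proof.
by rewrite !inE neighborE eq_sym -griddist_eq0; case: (griddist a c) => [|[|]].
Qed.

Lemma closed_nbhd_refl a : a \in closed_nbhd a.
Proof. by rewrite in_closed_nbhd /griddist /dist; lia. Qed.

(** By injectivity only one vertex carries the maximum of the neighborhood; it receives an edge from
    [a] unless it is [a] itself. *)
Lemma sink_argmax (f : labeling m n) a : injective f ->
  is_sink (gig_edge f) a = argmax f (closed_nbhd a) a.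
Proof.
move=> fI; rewrite /is_sink /outdegree cards_eq0.
apply/eqP/argmaxP => [H|[_ H]].
  split=> [|c ca]; first exact: closed_nbhd_refl.
  case: (@eq_bigmax_cond _ (mem (closed_nbhd a)) (label f)).
    by apply/card_gt0P; exists a; apply: closed_nbhd_refl.
  move=> b ba bmax.
  have: b \notin [set b | gig_edge f a b] by rewrite H inE.
  rewrite inE /gig_edge -bmax eqxx andbT negbK => /eqP ab.
  have := @leq_bigmax_cond _ (mem (closed_nbhd a)) (label f) c ca.
  by rewrite bmax -ab /label ltnS.
apply/setP=> b; rewrite !inE; apply/negbTE; rewrite negb_and negbK.
case: eqVneq => //= neq_ab; apply: contra neq_ab => /eqP bmax.
have amax : \max_(c in closed_nbhd a) label f c = label f a.
  apply/eqP; rewrite eqn_leq; apply/andP; split.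
    by apply/bigmax_leqP => c ca; rewrite /label ltnS; apply: H.
  exact: leq_bigmax_cond (closed_nbhd_refl a).
by apply/eqP/fI/val_inj; move: bmax; rewrite amax => -[].
Qed.

Lemma card_ord_eq k x : #|[set i : 'I_k | i == x :> nat]| = (x < k).
Proof.
have [xk|kx] := ltnP x k.
  rewrite /= -(cards1 (Ordinal xk)); apply: eq_card => i.
  by rewrite !inE -val_eqE.
apply/eqP; rewrite cards_eq0; apply/eqP/setP=> i; rewrite !inE.
by apply/eqP; have := ltn_ord i; lia.
Qed.

Lemma card_dist1 k (i : 'I_k) : #|[set i' : 'I_k | dist i i' == 1]| = path_degree k i.
Proof.
have -> : [set i' : 'I_k | dist i i' == 1] =
   [set i' : 'I_k | i' == i.+1 :> nat] :|: [set i' : 'I_k | i'.+1 == i :> nat].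
  by apply/setP=> i'; rewrite !inE /dist; lia.
rewrite cardsU card_ord_eq.
rewrite [X in _ - X](_ : _ = 0) ?subn0; last first.
  apply/eqP; rewrite cards_eq0; apply/eqP/setP=> i'; rewrite !inE; lia.
rewrite addnC /path_degree; congr (_ + _); have := ltn_ord i.
case: (nat_of_ord i) => [|x] xk.
  by apply/eqP; rewrite cards_eq0; apply/eqP/setP=> i'; rewrite !inE.
rewrite (_ : (0 < x.+1) = (x < k)); last by lia.
by rewrite -card_ord_eq; apply: eq_card => i'; rewrite !inE eqSS.
Qed.

(** The neighborhood splits into its center and two disjoint arms, one along each coordinate. *)
Lemma card_closed_nbhd a :
  #|closed_nbhd a| = (path_degree m a.1 + path_degree n a.2).+1.
Proof.
case: a => i j /=.
have -> : closed_nbhd (i, j) = (i, j) |: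
   (setX [set i' : 'I_m | dist i i' == 1] [set j] :|:
    setX [set i] [set j' : 'I_n | dist j j' == 1]).
  apply/setP=> -[i' j']; rewrite in_closed_nbhd !inE /griddist /= xpair_eqE.
  rewrite -!val_eqE /= ![_ == nat_of_ord i]eq_sym ![_ == nat_of_ord j]eq_sym.
  rewrite -(dist_eq0 i) -(dist_eq0 j).
  by case: (dist i i') (dist j j') => [|[|?]] [|[|?]].
rewrite cardsU1 cardsU !cardsX !cards1 !card_dist1.
rewrite [X in _ - X](_ : _ = 0) ?subn0; last first.
  apply/eqP; rewrite cards_eq0; apply/eqP/setP=> -[i' j'].
  rewrite !inE /= -!val_eqE /= [_ == nat_of_ord i]eq_sym -(dist_eq0 i).
  by case: (dist i i') => [|?]; rewrite ?andbF.
by rewrite muln1 mul1n !inE /= /dist !subnn andbF.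
Qed.

(** Diagonal points share the other two corners of their unit square, points two apart on a line
    share their midpoint, and the triangle inequality excludes common points beyond distance 2. *)
Lemma card_closed_nbhdI a b : 1 < griddist a b ->
  #|closed_nbhd a :&: closed_nbhd b| = overlap (dist a.1 b.1) (dist a.2 b.2).
Proof.
case: a b => [i j] [i' j']; rewrite /griddist /overlap /= => ab.
have inI x y : ((x, y) \in closed_nbhd (i, j) :&: closed_nbhd (i', j'))
    = (dist i x + dist j y <= 1) && (dist i' x + dist j' y <= 1).
  by rewrite in_setI !in_closed_nbhd.
have [/andP[/eqP di /eqP dj]|nd] := boolP (_ && _).
  have <- : #|[set (i, j'); (i', j)]| = 2.
    by rewrite cards2 xpair_eqE -val_eqE /= -(dist_eq0 i) di.
  apply: eq_card => -[x y]; rewrite inI in_set2 !xpair_eqE -!val_eqE /=.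
  rewrite ![nat_of_ord x == _]eq_sym ![nat_of_ord y == _]eq_sym.
  rewrite -(dist_eq0 i x) -(dist_eq0 i' x) -(dist_eq0 j y) -(dist_eq0 j' y).
  have := dist_triangle i i' x; have := dist_triangle j j' y.
  have := dist_triangle i x i'; have := dist_triangle j y j'.
  have := dist_triangle i' x i; have := dist_triangle j' y j.
  rewrite [dist i' i]distC [dist j' j]distC di dj.
  rewrite ![dist x _]distC ![dist y _]distC; clear.
  by move: (dist i x) (dist i' x) (dist j y) (dist j' y)
    => [|[|[|p]]] [|[|[|q]]] [|[|[|r]]] [|[|[|t]]].
have [d2|d2] := eqVneq; last first.
  apply/eqP; rewrite cards_eq0; apply/eqP/setP=> -[x y]; rewrite inI in_set0.
  have := dist_triangle i i' x; have := dist_triangle j j' y; lia.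
have mi := ltn_ord i; have mi' := ltn_ord i'.
have nj := ltn_ord j; have nj' := ltn_ord j'.
have hx : (i + i')./2 < m by lia.
have hy : (j + j')./2 < n by lia.
rewrite /= -(cards1 (Ordinal hx, Ordinal hy)); apply: eq_card => -[x y].
rewrite inI in_set1 xpair_eqE -!val_eqE /=.
have half (p q z : nat) : dist p q = 0 ->
    ((dist p z == 0) && (dist q z == 0)) = (z == (p + q)./2).
  move=> /eqP; rewrite dist_eq0 => /eqP <-; rewrite andbb dist_eq0 addnn doubleK.
  exact: eq_sym.
have T1 := dist_triangle i i' x; have T2 := dist_triangle j j' y.
case di: (dist i i') nd d2 T1 => [|[|[|?]]] //;
  case dj: (dist j j') T2 => [|[|[|?]]] //.
  rewrite -(half _ _ x di) -(dist_midpoint _ dj).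
  by case: (dist i x) (dist i' x) (dist j y) (dist j' y)
    => [|[|?]] [|[|?]] [|[|?]] [|[|?]].
rewrite -(half _ _ y dj) -(dist_midpoint _ di).
by case: (dist i x) (dist i' x) (dist j y) (dist j' y)
    => [|[|?]] [|[|?]] [|[|?]] [|[|?]].
Qed.

End Grid.

(** * Evaluating the double sum of covariances *)

Local Open Scope ring_scope.

Section GridSums.

Variable R : realFieldType.

(** Induction on the matrix size: a new last row and column each add at most two nonzero entries
    besides the corner. *)
Lemma sum_band (F : nat -> nat -> R) k :
    (forall i j, (2 < dist i j)%N -> F i j = 0) ->
  \sum_(i < k.+2) \sum_(j < k.+2) F i j
    = \sum_(i < k.+2) F i i + \sum_(i < k.+1) (F i i.+1 + F i.+1 i)
      + \sum_(i < k) (F i i.+2 + F i.+2 i).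
Proof.
move=> F0; elim: k => [|k IH]; first by rewrite !big_ord_recr !big_ord0 /=; ring.
rewrite big_ord_recr /=.
under eq_bigr => i _ do rewrite big_ord_recr /=.
rewrite big_split /= IH.
have rowE (G : nat -> R) : (forall i, (i < k)%N -> G i = 0) ->
    \sum_(i < k.+2) G i = G k + G k.+1.
  by move=> G0; rewrite !big_ord_recr /= big1 ?add0r // => i _; apply: G0.
rewrite (rowE (fun i => F i k.+2)) => [|i ik]; last by apply: F0; rewrite /dist; lia.
rewrite [\sum_(j < k.+3) F k.+2 j]big_ord_recr /= (rowE (fun i => F k.+2 i)).
  rewrite [\sum_(i < k.+3) F i i]big_ord_recr [\sum_(i < k.+2) (_ + _)]big_ord_recr.
  rewrite [\sum_(i < k.+1) (F i i.+2 + _)]big_ord_recr /=.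
  ring.
by move=> i ik; apply: F0; rewrite /dist; lia.
Qed.

Lemma sum_ends (G : nat -> R) k c : (forall i, (0 < i < k.+1)%N -> G i = c) ->
  \sum_(i < k.+2) G i = G 0%N + k%:R * c + G k.+1.
Proof.
move=> Gc; rewrite big_ord_recr big_ord_recl /=; congr (_ + _ + _).
rewrite (eq_bigr (fun=> c)) => [|i _]; last by apply: Gc; rewrite /= /bump ltnS ltn_ord.
by rewrite sumr_const card_ord mulr_natl.
Qed.

(** Only the two endpoints of a path have degree 1, so each diagonal of the band is constant except
    at its ends. From [4 <= m] on, points within distance 2 of an endpoint are interior. *)
Lemma sum_path_pairs (P : nat -> nat -> nat -> R) m : (4 <= m)%N ->
    (forall d x y, (2 < d)%N -> P d x y = 0) ->
  \sum_(i < m) \sum_(j < m) P (dist i j) (path_degree m i) (path_degree m j)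
  = 2%:R * (P 0 1 1)%N + (m%:R - 2%:R) * (P 0 2 2)%N
  + 2%:R * ((P 1 1 2)%N + (P 1 2 1)%N + (m%:R - 3%:R) * (P 1 2 2)%N)
  + 2%:R * ((P 2 1 2)%N + (P 2 2 1)%N + (m%:R - 4%:R) * (P 2 2 2)%N).
Proof.
case: m => [|[|[|[|k]]]] // _ P0.
pose b := path_degree k.+4.
rewrite (@sum_band (fun i j => P (dist i j) (b i) (b j))); last first.
  by move=> i j ?; apply: P0.
have bE i : (0 < i < k.+3)%N -> b i = 2%N by rewrite /b /path_degree; lia.
have b0 : b 0 = 1%N by [].
have bk : b k.+3 = 1%N by rewrite /b /path_degree; lia.
have d0 i : dist i i = 0%N by rewrite /dist; lia.
have d1 i : dist i i.+1 = 1%N by rewrite /dist; lia.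
have d1' i : dist i.+1 i = 1%N by rewrite /dist; lia.
have d2 i : dist i i.+2 = 2%N by rewrite /dist; lia.
have d2' i : dist i.+2 i = 2%N by rewrite /dist; lia.
rewrite (@sum_ends (fun i => P (dist i i) (b i) (b i)) _ (P 0 2 2)%N).
  2: by move=> i ?; rewrite d0 bE.
rewrite (@sum_ends (fun i => P (dist i i.+1) (b i) (b i.+1)
   + P (dist i.+1 i) (b i.+1) (b i)) _ ((P 1 2 2)%N *+ 2)).
  2: by move=> i ?; rewrite d1 d1' !bE //; lia.
rewrite (@sum_ends (fun i => P (dist i i.+2) (b i) (b i.+2)
   + P (dist i.+2 i) (b i.+2) (b i)) _ ((P 2 2 2)%N *+ 2)).
  2: by move=> i ?; rewrite d2 d2' !bE //; lia.
rewrite !(d0, d1, d1', d2, d2', b0, bk) !bE; try lia.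
by rewrite -!natr1; ring.
Qed.

(* Covariance of the sink indicators of two vertices whose coordinates differ by
   d and e and whose closed neighborhoods have p and q points. *)
Definition sink_cov (d e p q : nat) : R :=
  if (d + e == 0)%N then p%:R^-1 - p%:R^-1 ^+ 2
  else if (d + e == 1)%N then - (p%:R^-1 * q%:R^-1)
  else (overlap d e)%:R / ((p + q - overlap d e)%:R * p%:R * q%:R).

(** [sum_path_pairs] is applied to the rows with the whole column sum as [P], then to the columns
    for each fixed row data. *)
Lemma sum_sink_cov m n : (4 <= m)%N -> (4 <= n)%N ->
  \sum_(i < m) \sum_(i' < m) \sum_(j < n) \sum_(j' < n)
     sink_cov (dist i i') (dist j j') (path_degree m i + path_degree n j).+1
       (path_degree m i' + path_degree n j').+1
  = 13%:R * m%:R * n%:R / 225%:R + (m%:R + n%:R) / 150%:R + 52%:R / 1575%:R.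
Proof.
move=> hm hn.
have big_cov d e p q : (2 < d + e)%N -> sink_cov d e p q = 0.
  move=> h; have ov0 : overlap d e = 0%N by rewrite /overlap; case: ifP; lia.
  by rewrite /sink_cov ov0 mul0r; do 2 (case: eqP; first lia).
rewrite (@sum_path_pairs (fun d x y => \sum_(j < n) \sum_(j' < n)
     sink_cov d (dist j j') (x + path_degree n j).+1
       (y + path_degree n j').+1)) //; last first.
  move=> d x y hd; rewrite big1 // => j _; rewrite big1 // => j' _.
  by apply: big_cov; lia.
have sum_cols d x y := @sum_path_pairs (fun e z t =>
     sink_cov d e (x + z).+1 (y + t).+1) n hn.
rewrite !sum_cols; try by move=> e z t he; apply: big_cov; lia.
(* All arguments of [sink_cov] are numerals by now, so it computes and leaves a rational identity in
   [m] and [n]. *)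
rewrite /sink_cov /overlap /addn /subn /=.
by field.
Qed.

End GridSums.

(** * Expectation, covariance and variance of sums under the uniform law *)

Section Moments.

Variables (R : realFieldType) (T : finType) (S : {set T}).
Implicit Types X Y : T -> R.

Lemma eq_uniform_expectation X Y : {in S, X =1 Y} ->
  uniform_expectation S X = uniform_expectation S Y.
Proof. by move=> eqXY; congr (_ / _); apply: eq_bigr. Qed.

Lemma eq_uniform_variance X Y : {in S, X =1 Y} ->
  uniform_variance S X = uniform_variance S Y.
Proof.
move=> eqXY; rewrite /uniform_variance (eq_uniform_expectation eqXY).
by apply: eq_uniform_expectation => t /eqXY ->.
Qed.

Lemma uniform_expectation_sum (I : finType) (X : I -> T -> R) :
  uniform_expectation S (fun t => \sum_i X i t)
    = \sum_i uniform_expectation S (X i).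
Proof. by rewrite /uniform_expectation exchange_big mulr_suml. Qed.

Lemma uniform_covariance X Y : S != set0 ->
  uniform_expectation S (fun t =>
      (X t - uniform_expectation S X) * (Y t - uniform_expectation S Y))
  = uniform_expectation S (fun t => X t * Y t)
    - uniform_expectation S X * uniform_expectation S Y.
Proof.
move=> S0; have NS0 : #|S|%:R != 0 :> R by rewrite pnatr_eq0 cards_eq0.
set x := uniform_expectation S X; set y := uniform_expectation S Y.
have sX : \sum_(t in S) X t = x * #|S|%:R by rewrite divfK.
have sY : \sum_(t in S) Y t = y * #|S|%:R by rewrite divfK.
rewrite /uniform_expectation.
rewrite (eq_bigr (fun t => X t * Y t - y * X t - x * Y t + x * y)) => [|t _].
  2: by ring.
rewrite big_split /= !sumrB -!mulr_sumr sX sY sumr_const -mulr_natr.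
by field.
Qed.

Lemma uniform_variance_sum (I : finType) (X : I -> T -> R) : S != set0 ->
  uniform_variance S (fun t => \sum_i X i t)
  = \sum_i \sum_j (uniform_expectation S (fun t => X i t * X j t)
       - uniform_expectation S (X i) * uniform_expectation S (X j)).
Proof.
move=> S0; rewrite /uniform_variance uniform_expectation_sum.
under eq_uniform_expectation => t _ do rewrite -sumrB expr2 big_distrlr /=.
rewrite uniform_expectation_sum; apply: eq_bigr => i _.
rewrite uniform_expectation_sum; apply: eq_bigr => j _.
exact: uniform_covariance.
Qed.

Lemma uniform_expectation_indicator (P : pred T) :
  uniform_expectation S (fun t => (P t)%:R : R) = #|[set t in S | P t]|%:R / #|S|%:R.
Proof.
rewrite /uniform_expectation -natr_sum; congr (_%:R / _).
rewrite -sum1_card big_mkcond [RHS]big_mkcond; apply: eq_bigr => t _.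
by rewrite !inE; case: (t \in S) => //=; case: P.
Qed.

End Moments.

(** * First and second moments of the sink indicators *)

Section Sinks.

Variables (R : realFieldType) (m n : nat).
Implicit Types a b : vertex m n.

Let sink a (f : labeling m n) : R := (is_sink (gig_edge f) a)%:R.
Local Notation Ex := (uniform_expectation (labelings m n)).

Lemma card_labelings_neq0 : #|labelings m n|%:R != 0 :> R.
Proof. by rewrite card_labelings pnatr_eq0 -lt0n fact_gt0. Qed.

Lemma labeling_inj (f : labeling m n) : f \in labelings m n -> injective f.
Proof. by rewrite inE => /andP[/injectiveP]. Qed.

Lemma expectation_sink a : Ex (sink a) = (#|closed_nbhd a|%:R)^-1.
Proof.
pose E (f : labeling m n) := argmax f (closed_nbhd a) a.
rewrite (@eq_uniform_expectation _ _ _ _ (fun f => (E f)%:R)); last first.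
  by move=> f /labeling_inj fI; rewrite /sink sink_argmax.
rewrite uniform_expectation_indicator labelingsE.
have := card_labelings_neq0; rewrite labelingsE.
rewrite -(card_argmax1 _ (closed_nbhd_refl a)) natrM mulf_eq0 negb_or => /andP[x0 p0].
by field; rewrite x0 p0.
Qed.

Lemma expectation_sink2 a b : (1 < griddist a b)%N ->
  Ex (fun f => sink a f * sink b f)
  = (#|closed_nbhd a|%:R + #|closed_nbhd b|%:R)
    / (#|closed_nbhd a :|: closed_nbhd b|%:R
       * #|closed_nbhd a|%:R * #|closed_nbhd b|%:R).
Proof.
move=> ab; have bNa : b \notin closed_nbhd a by rewrite in_closed_nbhd -ltnNge.
have aNb : a \notin closed_nbhd b.
  by rewrite in_closed_nbhd /griddist distC [dist b.2 _]distC -ltnNge.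
have aa := closed_nbhd_refl a; have bb := closed_nbhd_refl b.
pose E (f : labeling m n) := argmax f (closed_nbhd a) a && argmax f (closed_nbhd b) b.
rewrite (@eq_uniform_expectation _ _ _ _ (fun f => (E f)%:R)); last first.
  by move=> f /labeling_inj fI; rewrite /sink !sink_argmax // -natrM mulnb.
rewrite uniform_expectation_indicator.
have cE := card_argmax2 (m * n) aa bb aNb bNa.
have N0 := card_labelings_neq0; rewrite labelingsE in N0 *.
have p0 : (0 < #|closed_nbhd a|)%N by apply/card_gt0P; exists a.
have q0 : (0 < #|closed_nbhd b|)%N by apply/card_gt0P; exists b.
have u0 : (0 < #|closed_nbhd a :|: closed_nbhd b|)%N.
  by apply/card_gt0P; exists a; rewrite in_setU aa.
apply/eqP; rewrite -natrD -!natrM eqr_div -?natrM ?cE //.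
by rewrite pnatr_eq0 -lt0n !muln_gt0 u0 p0 q0.
Qed.

Lemma sink_covariance a b :
  Ex (fun f => sink a f * sink b f) - Ex (sink a) * Ex (sink b)
  = sink_cov R (dist a.1 b.1) (dist a.2 b.2)
      (path_degree m a.1 + path_degree n a.2).+1
      (path_degree m b.1 + path_degree n b.2).+1.
Proof.
rewrite !expectation_sink /sink_cov -!card_closed_nbhd -/(griddist a b).
case: eqVneq => [/eqP|ab0].
  (* An indicator is its own square. *)
  rewrite griddist_eq0 => /eqP <-; rewrite -expectation_sink; congr (_ - _).
  by apply: eq_uniform_expectation => f _; rewrite /sink -natrM mulnb andbb.
case: eqVneq => [ab1|ab1].
  rewrite (@eq_uniform_expectation _ _ _ _ (fun=> 0)).
    by rewrite /uniform_expectation big1 // mul0r sub0r.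
  move=> f /labeling_inj fI; rewrite /sink !sink_argmax // -natrM mulnb.
  case: (boolP (_ && _)) => // /andP[/argmaxP[_ Ha] /argmaxP[_ Hb]].
  have ba : b \in closed_nbhd a by rewrite in_closed_nbhd ab1.
  have ab : a \in closed_nbhd b.
    by rewrite in_closed_nbhd /griddist distC [dist b.2 _]distC -/(griddist a b) ab1.
  move: ab0; rewrite griddist_eq0 => /eqP[]; apply/fI/val_inj/eqP.
  by rewrite eqn_leq Ha ?Hb.
have ab : (1 < griddist a b)%N by lia.
(* With u = p + q - c by inclusion-exclusion, (p + q)/(upq) - 1/(pq) = c/(upq). *)
rewrite expectation_sink2 // -card_closed_nbhdI // -cardsU.
set p := #|closed_nbhd a|; set q := #|closed_nbhd b|.
set u := #|_ :|: _|; set c := #|_ :&: _|.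
have pE : p = (path_degree m a.1 + path_degree n a.2).+1 by apply: card_closed_nbhd.
have qE : q = (path_degree m b.1 + path_degree n b.2).+1 by apply: card_closed_nbhd.
have uE : (u + c = p + q)%N by apply: cardsUI.
have le_pu : (p <= u)%N by apply/subset_leq_card/subsetUl.
have -> : c%:R = p%:R + q%:R - u%:R :> R by rewrite -natrD -uE natrD; ring.
have [u0 p0 q0] : [/\ u%:R != 0 :> R, p%:R != 0 :> R & q%:R != 0 :> R].
  by rewrite !pnatr_eq0; split; lia.
by field; rewrite u0 p0 q0.
Qed.

End Sinks.

Theorem theorem3p3 (R : realFieldType) (m n : nat)
    (hm : (6 <= m)%N) (hn : (6 <= n)%N) :
  uniform_variance (labelings m n)
      (fun f : labeling m n => (num_sinks (gig_edge f))%:R : R)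
  = 13%:R * m%:R * n%:R / 225%:R + (m%:R + n%:R) / 150%:R + 52%:R / 1575%:R.
Proof.
have [hm4 hn4] : (4 <= m)%N /\ (4 <= n)%N by lia.
have L0 : labelings m n != set0.
  by rewrite -card_gt0 card_labelings fact_gt0.
pose sink (a : vertex m n) (f : labeling m n) : R := (is_sink (gig_edge f) a)%:R.
transitivity (uniform_variance (labelings m n) (fun f => \sum_a sink a f)).
  apply: eq_uniform_variance => f _.
  rewrite /num_sinks -sum1_card natr_sum big_mkcond /=.
  by apply: eq_bigr => a _; rewrite inE /sink; case: is_sink.
rewrite uniform_variance_sum // -(sum_sink_cov R hm4 hn4).
under eq_bigr => a _ do under eq_bigr => b _ do rewrite sink_covariance.
(* Swapping the two middle sums puts the coordinates of each vertex side by side, ready to be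
   paired. *)
under [RHS]eq_bigr => i _ do rewrite exchange_big /=.
rewrite [RHS]pair_bigA; apply: eq_bigr => a _ /=.
by rewrite [RHS]pair_bigA.
Qed.
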